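(* Let $Y=\beta\mathbb N\setminus\mathbb N$ and let $X=C_p(Y,\{0,1\})$ be the space of all continuous functions $x:Y\to\{0,1\}$ with the topology of pointwise convergence. Then the following conditions are equivalent: (i) $X$ is meagre (in itself); (ii) $X$ is not a Baire space; (iii) there exists a sequence $(E_n)_{n=1}^\infty$ of nonempty finite pairwise disjoint sets $E_n\subseteq Y$ which weakly converges to some point $y_0\in Y$; (iv) there exists a sequence $(E_n)_{n=1}^\infty$ of nonempty finite pairwise disjoint sets $E_n\subseteq Y$ which weakly converges to every point $y\in\bigcup_{n=1}^\infty E_n$.
   Context: $\beta\mathbb N$ is the Stone–Čech compactification of the countable discrete space $\mathbb N$, $\beta\mathbb N\setminus\mathbb N$ carries the subspace topology, and $\{0,1\}$ is discrete. Weak convergence of a sequence of sets: a sequence $(A_n)_{n=1}^\infty$ of subsets of a topological space $Y$ weakly converges to a point $y_0\in Y$ (in $Y$) if for every neighborhood $U$ of $y_0$ in $Y$ there exists $n_0\in\mathbb N$ such that $U\cap A_n\neq\emptyset$ for every $n\ge n_0$. *)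

(* Defs.v *)
From HB Require Import structures.
From mathcomp Require Import all_boot all_order all_algebra.
From mathcomp Require Import all_classical all_reals all_analysis.

Set Implicit Arguments.
Unset Strict Implicit.
Unset Printing Implicit Defensive.

Local Open Scope classical_set_scope.

Definition nowhere_dense (T : topologicalType) (A : set T) :=
  interior (closure A) = set0.

Definition meagre (T : topologicalType) (A : set T) :=
  exists F : nat -> set T,
    (forall n, nowhere_dense (F n)) /\ A = \bigcup_n F n.

Definition Baire_space (T : topologicalType) :=
  forall O : nat -> set T,
    (forall n, open (O n) /\ dense (O n)) -> dense (\bigcap_n O n).

Definition weakly_converges (T : topologicalType) (A : nat -> set T) (y0 : T) :=
  forall U : set T, nbhs y0 U ->
    exists n0 : nat, forall n, (n0 <= n)%N -> U `&` A n !=set0.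

Definition Cp (Y T : topologicalType) : topologicalType :=
  initial_topology (id : continuousType Y T -> {ptws Y -> T}).

(* The characterization (up to a unique homeomorphism under X) of the
   Stone-Cech compactification i : X -> B of a Tychonoff space X. *)
Definition is_stone_cech (X B : topologicalType) (i : X -> B) :=
  [/\ compact [set: B] /\ hausdorff_space B,
      injective i,
      forall U : set X, open U <-> exists2 V : set B, open V & i @^-1` V = U,
      dense (range i)
    & forall (K : topologicalType) (f : X -> K),
        compact [set: K] -> hausdorff_space K -> continuous f ->
        exists2 g : B -> K, continuous g & forall x, g (i x) = f x].

(* Beta N, realized as the space of all ultrafilters on nat; the lemma
   betaN_stone_cech below checks that it is the Stone-Cech compactification
   of the discrete space nat. *)
Record betaN : Type := BetaN {
  ultra_sets :> set_system nat;
  ultra_setsP : UltraFilter ultra_sets }.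

#[global] Existing Instance ultra_setsP.

HB.instance Definition _ := gen_eqMixin betaN.
HB.instance Definition _ := gen_choiceMixin betaN.

Definition betaN_base (A : set nat) : set betaN := [set u | ultra_sets u A].

Lemma betaN_base_cover :
  \bigcup_(A in [set: set nat]) betaN_base A = [set: betaN].
Proof.
by apply/seteqP; split=> // u _; exists setT => //; exact: filterT.
Qed.

Lemma betaN_base_join (A B : set nat) (u : betaN) :
  [set: set nat] A -> [set: set nat] B -> betaN_base A u -> betaN_base B u ->
  exists C, [/\ [set: set nat] C, betaN_base C u
              & betaN_base C `<=` betaN_base A `&` betaN_base B].
Proof.
move=> _ _ uA uB; exists (A `&` B); split => //; first exact: filterI.
by move=> v vAB; split; apply: filterS vAB => x [].
Qed.

(* The topology whose base consists of the sets of ultrafilters containing a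
   given set of natural numbers. *)
HB.instance Definition _ :=
  isBaseTopological.Build betaN betaN_base_cover betaN_base_join.

Definition betaN_of_nat (n : nat) : betaN :=
  BetaN (principal_filter_ultra n).

Definition betaN_remainder : set betaN := ~` range betaN_of_nat.

Definition Nstar : topologicalType := set_type betaN_remainder.

Lemma betaN_eq (u v : betaN) :
  (forall A, ultra_sets u A -> ultra_sets v A) -> u = v.
Proof.
case: u v => [u uU] [v vU] /= uv.
have E : v = u by exact: max_filter.
by subst v; congr BetaN; exact: Prop_irrelevance.
Qed.

Lemma open_betaN_base A : open (betaN_base A).
Proof. by exists [set A] => //; rewrite bigcup_set1. Qed.

Lemma nbhs_betaNP (u : betaN) (U : set betaN) :
  nbhs u U <-> exists2 A, ultra_sets u A & betaN_base A `<=` U.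
Proof.
split=> [|[A uA AU]]; last first.
  rewrite nbhsE; exists (betaN_base A) => //.
  by split=> //; exact: open_betaN_base.
rewrite nbhsE => -[V [[D _ <-] [A DA uA]] VU].
by exists A => // v vA; apply: VU; exists A.
Qed.

Lemma ultra_of_nat n (A : set nat) : ultra_sets (betaN_of_nat n) A <-> A n.
Proof. exact: principal_filterP. Qed.

Lemma ultra_notC (u : betaN) (A : set nat) :
  ultra_sets u A -> ~ ultra_sets u (~` A).
Proof.
move=> uA uC; have : ultra_sets u (A `&` ~` A) by exact: filterI.
by rewrite setICr => /filter_not_empty.
Qed.

Lemma betaN_stone_cech : is_stone_cech betaN_of_nat.
Proof.
split.
- split.
    rewrite compact_ultra => F FU _.
    pose S : set_system nat := [set A | F (betaN_base A)].
    have SF : Filter S.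
      split.
      - have : F setT by exact: filterT.
        by apply: filterS => u _; exact: filterT.
      - move=> A B FA FB.
        have : F (betaN_base A `&` betaN_base B) by exact: filterI.
        by apply: filterS => u [uA uB]; exact: filterI.
      - by move=> A B AB; apply: (@filterS _ F) => u; exact: filterS.
    have SP : ProperFilter S.
      split=> // F0; apply: (@filter_not_empty _ F).
      by apply: (@filterS _ F _ (betaN_base set0)) => // u /filter_not_empty.
    have SU : UltraFilter S.
      split=> // G GP SG; apply/seteqP; split=> // A GA.
      have [//|FnA] := in_ultra_setVsetC (betaN_base A) FU.
      have GnA : G (~` A).
        apply: SG; apply: filterS FnA => u nuA.
        by have [] := in_ultra_setVsetC A (ultra_setsP u).
      have : G (A `&` ~` A) by exact: filterI.
      by rewrite setICr => /filter_not_empty.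
    exists (BetaN SU); split => // U /nbhs_betaNP[A SA AU].
    exact: (@filterS _ F _ (betaN_base A)).
  move=> u v uv; apply: betaN_eq => A uA; apply: contrapT => nvA.
  have vC : ultra_sets v (~` A).
    by have [] := in_ultra_setVsetC A (ultra_setsP v).
  have [||w [wA wC]] := uv (betaN_base A) (betaN_base (~` A)).
  - by apply/nbhs_betaNP; exists A.
  - by apply/nbhs_betaNP; exists (~` A).
  - exact: (ultra_notC wA wC).
- move=> m n mn.
  have /ultra_of_nat : ultra_sets (betaN_of_nat m) [set m].
    by apply/ultra_of_nat.
  move=> _; have : ultra_sets (betaN_of_nat n) [set m].
    by rewrite -mn; apply/ultra_of_nat.
  by move/ultra_of_nat.
- move=> U; split=> [_|_].
    exists (betaN_base U); first exact: open_betaN_base.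
    by apply/seteqP; split=> n /ultra_of_nat.
  exact: discrete_open.
- move=> O [u Ou] oO.
  have /nbhs_betaNP[A uA AO] : nbhs u O by exact: open_nbhs_nbhs.
  have [n An] := filter_ex uA.
  by exists (betaN_of_nat n); split; [apply: AO; apply/ultra_of_nat|exists n].
move=> K f cK hK _.
have cvgP (u : betaN) : exists p : K, f @ ultra_sets u --> p.
  have [p [_ pc]] := cK (f @ ultra_sets u) _ filterT.
  exists p => U /nbhs_interior; rewrite nbhsE.
  move=> [V [oV Vp] VU]; rewrite /= nbhs_simpl.
  have [//|fC] := in_ultra_setVsetC (f @^-1` V) (ultra_setsP u).
    by move=> uV; apply: filterS uV => x /VU; exact: nbhs_singleton.
  have [] := pc (~` V) V; last by move=> x [].
    exact: fC.
  exact: open_nbhs_nbhs.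
have [g gP] := choice cvgP.
exists g; last first.
  move=> n; apply: hK => A B nA nB.
  have /ultra_of_nat fA := gP _ _ nA.
  by exists (f n); split=> //; exact: nbhs_singleton.
move=> u U /= guU; rewrite nbhs_simpl/=.
have [V gV VU] := compact_regular hK cK (@filterT _ (nbhs (g u)) _) guU.
apply/nbhs_betaNP; exists (f @^-1` V); first exact: gP.
move=> v vV /=; apply: VU => B vB.
by have [n [Vn Bn]] := filter_ex (filterI vV (gP _ _ vB)); exists (f n).
Qed.

(* Main.v *)
Require Import Defs.
From mathcomp Require Import all_boot all_order all_algebra.
From mathcomp Require Import all_classical all_reals all_analysis.

(** Everything turns on one subsequence argument and one extension property.

    Diagonalization ([weak_limit_dichotomy]): a sequence of sets can be thinned
    out so that each point of a prescribed countable set P is either a weak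
    limit of the thinned sequence or has a neighborhood that misses almost all
    of its terms.  If the E_n are finite and P contains their union, a point
    of the union of the second kind is isolated in the union.

    Extension ([relatively_discrete_extension]): in the remainder of beta N,
    two countable sets neither of which meets the closure of the other are
    separated by a clopen set.  Hence every two-valued function on a countable
    relatively discrete set is the restriction of a continuous one.

    (i) implies (ii) because X is nonempty.

    (ii) implies (iii), by contraposition.  Let O_n be dense open sets, which
    may be taken decreasing, and let s be a finite condition.  There are
    disjoint finite sets E_n, off the domain of s, with functions e_n on them,
    such that agreeing with e_n on E_n is enough to belong to O_n
    ([forcing_block]).  If nothing is a weak limit of disjoint finite sets,
    the dichotomy thins the E_n out so that their union with the domain of s
    is relatively discrete; a continuous x extending s and the remaining e_n
    then lies in all the O_n.

    (iii) implies (iv).  Thin out E_n -> y0 by the dichotomy, and let L be the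
    set of all weak limits of the thinned sequence.  The sets E_n `&` L still
    converge weakly to every point of L ([weakly_converges_to_limits]):
    otherwise the points of infinitely many E_n in some neighborhood U of a
    point of L are all isolated, a clopen set separates those with even index
    from those with odd index, and so the point of L has a neighborhood that
    misses infinitely many E_n.  Since y0 is in L, the sets E_n `&` L are
    nonempty from some index on.

    (iv) implies (i).  Let y0 be a weak limit.  A continuous x takes the value
    x y0 near y0, hence somewhere on E_k for all large k; but for either value
    b, the functions taking the value b somewhere on each E_k with k >= m form
    a nowhere dense set, as a finite condition constrains only finitely many of
    the disjoint E_k. *)

Set Implicit Arguments.
Unset Strict Implicit.
Unset Printing Implicit Defensive.

Local Open Scope classical_set_scope.

(** * Thinning out sequences *)

Lemma homo_ltn_geid (f : nat -> nat) :
  {homo f : m n / (m < n)%N} -> forall n, (n <= f n)%N.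
Proof.
by move=> fI; elim=> // n IH; apply: leq_ltn_trans IH (fI _ _ (ltnSn n)).
Qed.

Lemma homo_ltn_trivIset (T : Type) (E : nat -> set T) (f : nat -> nat) :
  {homo f : m n / (m < n)%N} ->
  trivIset [set: nat] E -> trivIset [set: nat] (E \o f).
Proof.
move=> fI tE i j _ _ Eij; have fij := tE _ _ Logic.I Logic.I Eij.
by case: (ltngtP i j) => // /fI; rewrite fij ltnn.
Qed.

Lemma frequently_subsequence (P : nat -> Prop) :
  (forall m, exists2 n, (m <= n)%N & P n) ->
  exists2 f : nat -> nat, {homo f : m n / (m < n)%N} & forall k, P (f k).
Proof.
move=> Pinf.
have [|h hP] := @choice _ _ (fun m n => (m <= n)%N /\ P n).
  by move=> m; have [n ? ?] := Pinf m; exists n.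
pose f := fix f k := if k is k'.+1 then h (f k').+1 else h 0%N.
exists f; last by case=> [|k] /=; exact: (hP _).2.
by apply: homo_ltn => [|k]; [exact: ltn_trans | exact: (hP _).1].
Qed.

(** Iterated refinement followed by a diagonal: at stage k pass to a subsequence
    with the hereditary property [C k] if there is one.  The diagonal sequence
    is eventually a subsequence of each stage, so if stage k found nothing to
    pass to, no further subsequence of the diagonal has [C k]. *)
Lemma diagonal_subsequence (C : nat -> set nat -> Prop) :
  (forall k (I J : set nat), J `<=` I -> C k I -> C k J) ->
  exists2 f : nat -> nat, {homo f : m n / (m < n)%N} &
    forall k, (exists m, C k [set f n | n in [set n | (m <= n)%N]]) \/
      (forall g : nat -> nat, {homo g : m n / (m < n)%N} ->
         ~ C k (range (f \o g))).
Proof.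
move=> Cmono.
pose inc := [set s : nat -> nat | {homo s : m n / (m < n)%N}].
have step (sk : (nat -> nat) * nat) : exists t : nat -> nat, inc sk.1 ->
    inc t /\ (C sk.2 (range (sk.1 \o t)) \/
      forall g, inc g -> ~ C sk.2 (range (sk.1 \o g))).
  case: sk => s k /=.
  have [[t [tI Ct]]|nC] := pselect (exists t, inc t /\ C k (range (s \o t))).
    by exists t; split=> //; left.
  by exists id => _; split=> //; right=> g gI Cg; apply: nC; exists g.
have [h hP] := choice step.
pose S := fix S k := if k is k'.+1 then S k' \o h (S k', k') else id.
have SI k : inc (S k).
  elim: k => [|k IH] //= m n mn.
  by have [hI _] := hP (S k, k) IH; exact/IH/hI.
have SS k j : exists2 t, inc t & S (k + j)%N = S k \o t.
  elim: j => [|j [t tI E]]; first by exists id => //; rewrite addn0.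
  rewrite addnS /=; have [hI _] := hP (S (k + j)%N, (k + j)%N) (SI _).
  exists (t \o h (S (k + j)%N, (k + j)%N)); last by rewrite {1}E.
  by move=> m n mn; exact/tI/hI.
pose f n := S n n.
have fI : inc f.
  apply: homo_ltn => [|n]; first exact: ltn_trans.
  rewrite /f; have [hI _] := hP (S n, n) (SI n).
  by apply: (SI n); exact: (homo_ltn_geid hI).
have tail k n : (k <= n)%N -> range (S k) (f n).
  move=> kn; have [t _ E] := SS k (n - k)%N.
  by rewrite /f -{1}(subnKC kn) E; exists (t n).
exists f => // k; have [_ [Ck|nC]] := hP (S k, k) (SI k).
  left; exists k.+1; apply: Cmono Ck => _ [n kn <-].
  exact: (tail k.+1).
(* The shift by k puts all the values of g beyond stage k. *)
right=> g gI Cg; pose r n := f (g (n + k)%N).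
have rS n : exists p, S k p = r n.
  have [|p _ E] := tail k (g (n + k)%N); last by exists p.
  by apply: leq_trans (homo_ltn_geid gI _); exact: leq_addl.
have [p pP] := choice rS.
apply: (nC p).
  move=> m n mn; have: (r m < r n)%N by apply/fI/gI; rewrite ltn_add2r.
  rewrite -!pP.
  case: (ltngtP (p m) (p n)) => // [/(SI k) nm /(ltn_trans nm)|->];
  by rewrite ltnn.
apply: Cmono Cg => _ [n _ <-]; exists (n + k)%N => //.
by rewrite /= pP.
Qed.

(** * Weak limits *)

Definition relatively_discrete (T : topologicalType) (D : set T) :=
  forall y, D y -> exists2 U, nbhs y U & U `&` D `<=` [set y].

Lemma weakly_converges_subsequence (T : topologicalType) (E : nat -> set T)
    (f : nat -> nat) (y : T) :
  {homo f : m n / (m < n)%N} -> weakly_converges E y ->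
  weakly_converges (E \o f) y.
Proof.
move=> fI Ey U /Ey[n0 n0P]; exists n0 => n n0n.
by apply: n0P; apply: leq_trans n0n _; exact: homo_ltn_geid.
Qed.

Lemma countable_eq_range (T : Type) (A : set T) :
  countable A -> A = set0 \/ exists f : nat -> T, A = range f.
Proof.
by move=> /pfcard_geP[->|[f]]; [left|right; exists f; rewrite image_eq].
Qed.

(** For a single y, if y is not a weak limit then infinitely many [E n] miss a
    neighborhood of y, and restricting to these indices puts y in the second
    case, which further thinning out preserves; the diagonal does this for all
    points of [P] at once. *)
Lemma weak_limit_dichotomy (T : topologicalType) (E : nat -> set T)
    (P : set T) :
  countable P ->
  exists2 f : nat -> nat, {homo f : m n / (m < n)%N} &
    forall y, P y -> weakly_converges (E \o f) y \/
      exists2 U, nbhs y U &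
        exists m, forall n, (m <= n)%N -> U `&` E (f n) = set0.
Proof.
move=> /countable_eq_range[->|[p ->]]; first by exists id.
pose C k (I : set nat) :=
  exists2 U, nbhs (p k) U & forall n, I n -> U `&` E n = set0.
have [|f fI fP] := @diagonal_subsequence C.
  by move=> k I J JI [U pU UI]; exists U => // n /JI/UI.
exists f => // _ [k _ <-].
have [[m [U pU Um]]|nC] := fP k.
  by right; exists U => //; exists m => n mn; apply: Um; exists n.
left=> U pU; apply: contrapT => nn0.
have [|g gI gP] := @frequently_subsequence (fun n => U `&` E (f n) = set0).
  move=> m; apply: contrapT => nm; apply: nn0; exists m => n mn.
  by apply/set0P/eqP => UE; apply: nm; exists n.
by apply: (nC g gI); exists U => // _ [n _ <-]; exact: gP.
Qed.

Lemma isolate_from_finite (T : topologicalType) (A : set T) (y : T) :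
  hausdorff_space T -> finite_set A ->
  exists2 U, nbhs y U & U `&` A `<=` [set y].
Proof.
move=> hT fA; exists (~` (A `\ y)).
  apply: open_nbhs_nbhs; split; last by case=> _; exact.
  rewrite openC.
  apply: (accessible_finite_set_closed.1 (hausdorff_accessible hT)).
  exact: finite_setD.
by move=> z [nAz Az]; apply: contrapT => zy; apply: nAz.
Qed.

(** * Countable separated sets in the remainder of beta N *)

Lemma nbhs_NstarP (y : Nstar) (U : set Nstar) :
  nbhs y U <-> exists2 A, ultra_sets (set_val y) A &
                 forall z : Nstar, ultra_sets (set_val z) A -> U z.
Proof.
split=> [|[A yA AU]].
  rewrite nbhsE => -[V [[W oW <-] Wy] VU].
  have /nbhs_betaNP[A yA AW] : nbhs (set_val y) W by exact: open_nbhs_nbhs.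
  by exists A => // z zA; apply: VU; exact: AW.
rewrite nbhsE; exists (set_val @^-1` betaN_base A) => //.
by split=> //; exists (betaN_base A) => //; exact: open_betaN_base.
Qed.

Lemma ultra_em (u : betaN) (A : set nat) :
  ultra_sets u A \/ ultra_sets u (~` A).
Proof. exact: in_ultra_setVsetC (ultra_setsP u). Qed.

Lemma Nstar_hausdorff : hausdorff_space Nstar.
Proof.
move=> y z yz; apply: val_inj; apply: betaN_eq => A yA.
have [//|zC] := ultra_em (set_val z) A.
have [|| w [wA wC]] := yz [set w | ultra_sets (set_val w) A]
    [set w | ultra_sets (set_val w) (~` A)].
- by apply/nbhs_NstarP; exists A.
- by apply/nbhs_NstarP; exists (~` A).
- by case: (ultra_notC wA wC).
Qed.

Lemma continuous_mem_ultra (S : set nat) :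
  continuous (fun y : Nstar => `[< ultra_sets (set_val y) S >] : bool).
Proof.
move=> y U; rewrite /= => /nbhs_singleton Uy; apply/nbhs_NstarP.
have [yS|yS] := ultra_em (set_val y) S; [exists S|exists (~` S)] => // z zS;
  rewrite /=; move: Uy.
- by rewrite !asboolT.
- by rewrite !asboolF // => /ultra_notC; apply.
Qed.

Lemma ultra_avoid (u : betaN) (B : nat -> set nat) n :
  (forall j, ~ ultra_sets u (B j)) ->
  ultra_sets u [set m | forall j, (j < n)%N -> ~ B j m].
Proof.
move=> nB; elim: n => [|n IH]; first by apply: filterS filterT => m _ j.
have uC : ultra_sets u (~` B n) by have [/nB|] := ultra_em u (B n).
apply: filterS (filterI IH uC) => m [IHm nBm] j.
by rewrite ltnS leq_eqVlt => /predU1P[->|/IHm].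
Qed.

(** Choose for the points a_i of [A] sets SA_i in a_i that belong to no point of
    [B], and symmetrically SB_j for the points b_j of [B].  Removing from SA_i
    the SB_j with j <= i and from SB_j the SA_i with i < j keeps them in a_i
    and b_j, and makes the first family disjoint from the second.  The union
    of the reduced SA_i is the required set. *)
Lemma separated_countable_Nstar (A B : set Nstar) :
  countable A -> countable B ->
  (forall a, A a -> exists2 U, nbhs a U & U `&` B = set0) ->
  (forall b, B b -> exists2 U, nbhs b U & U `&` A = set0) ->
  exists S : set nat, (forall a, A a -> ultra_sets (set_val a) S) /\
                      (forall b, B b -> ~ ultra_sets (set_val b) S).
Proof.
move=> /countable_eq_range[->|[a ->]].
  by exists set0; split=> // b _ /filter_not_empty.
move=> /countable_eq_range[->|[b ->]].
  by exists setT; split=> // ? _; exact: filterT.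
move=> aB bA.
have trace (y : Nstar) (D : set Nstar) :
    (exists2 U, nbhs y U & U `&` D = set0) ->
    exists C, ultra_sets (set_val y) C /\
      forall d, D d -> ~ ultra_sets (set_val d) C.
  move=> [U /nbhs_NstarP[C yC CU] UD]; exists C; split=> // d Dd dC.
  by have : (U `&` D) d; [split=> //; exact: CU | rewrite UD].
have [SA SAP] := choice (fun i => trace _ _ (aB (a i) (imageT a i))).
have [SB SBP] := choice (fun i => trace _ _ (bA (b i) (imageT b i))).
exists [set m | exists2 i, SA i m & forall j, (j < i.+1)%N -> ~ SB j m]; split.
  move=> _ [i _ <-].
  have ai := @ultra_avoid (set_val (a i)) SB i.+1.
  have {}ai := ai (fun j => (SBP j).2 _ (imageT a i)).
  by apply: filterS (filterI (SAP i).1 ai) => m [Sm Sn]; exists i.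
move=> _ [j _ <-] bS.
have bj := @ultra_avoid (set_val (b j)) SA j
  (fun i => (SAP i).2 _ (imageT b j)).
have [m [[i im ni] [mB nA]]] := filter_ex (filterI bS (filterI (SBP j).1 bj)).
have [ij|ji] := ltnP i j; first exact: (nA i).
exact: (ni j).
Qed.

(** Neither of the two fibers of g in D meets the closure of the other. *)
Lemma relatively_discrete_extension (D : set Nstar) (g : Nstar -> bool) :
  countable D -> relatively_discrete D ->
  exists x : continuousType Nstar bool, forall y, D y -> x y = g y.
Proof.
move=> cD dD.
have sep b y : (D `&` g @^-1` [set b]) y ->
    exists2 U, nbhs y U & U `&` (D `&` g @^-1` [set ~~ b]) = set0.
  move=> [/dD[U yU UD] /= gy]; exists U => //.
  apply/seteqP; split=> // z [Uz [Dz /= gz]].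
  by move: gz; rewrite (UD z) // gy; case: (b).
have [|||| S [S1 S0]] := @separated_countable_Nstar
   (D `&` g @^-1` [set true]) (D `&` g @^-1` [set false]).
- by apply: sub_countable cD; apply: subset_card_le => y [].
- by apply: sub_countable cD; apply: subset_card_le => y [].
- exact: sep true.
- exact: sep false.
exists (mkcts (@continuous_mem_ultra S)) => y Dy; rewrite /mkcts.
case gy: (g y); first by apply/asboolP/S1.
by apply/asboolPn/S0.
Qed.

(** * The function space *)

Definition Cp_eval (Y T : topologicalType) (x : Cp Y T) : Y -> T :=
  (x : continuousType Y T).

Lemma Cp_eval_continuous (Y T : topologicalType) (x : Cp Y T) :
  continuous (Cp_eval x).
Proof. exact: (@cts_fun _ _ (x : continuousType Y T)). Qed.

Lemma nbhs_CpP (Y : topologicalType) (x : Cp Y bool) (U : set (Cp Y bool)) :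
  nbhs x U <-> exists s : seq Y, forall z : Cp Y bool,
    {in s, Cp_eval z =1 Cp_eval x} -> U z.
Proof.
split=> [|[s]]; last first.
  elim: s U => [|y s IH] U sU.
    by apply: filterS filterT => z _; exact: sU.
  have ny : nbhs x [set z : Cp Y bool | Cp_eval z y = Cp_eval x y].
    have /= :=
      @initial_continuous (continuousType Y bool) {ptws Y -> bool} id x.
    move=> /(_ [set f | f y = Cp_eval x y]); apply.
    apply: (@proj_continuous Y (fun=> bool) y (Cp_eval x)
              [set b | b = Cp_eval x y]).
    exact: discrete_set1.
  have ns : nbhs x [set z : Cp Y bool | {in s, Cp_eval z =1 Cp_eval x}].
    exact: IH.
  apply: filterS (filterI ny ns) => z [zy zs]; apply: sU => t.
  by rewrite inE => /predU1P[->|/zs].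
(* The sets determined by finitely many values form a filter G that converges
   pointwise to x; hence G contains every neighborhood of x. *)
pose G : set_system (Cp Y bool) := [set W | exists s : seq Y,
  forall z : Cp Y bool, {in s, Cp_eval z =1 Cp_eval x} -> W z].
have FG : Filter G.
  split; first by exists [::].
    move=> V W [s sV] [t tW]; exists (s ++ t) => z zst; split.
      by apply: sV => y ys; apply: zst; rewrite mem_cat ys.
    by apply: tW => y yt; apply: zst; rewrite mem_cat yt orbT.
  by move=> V W VW [s sV]; exists s => z /sV/VW.
rewrite nbhsE => -[_ [[W oW <-] Wx] WU].
have cvgG : @Cp_eval Y bool @ G --> (Cp_eval x : {ptws Y -> bool}).
  apply/pointwise_cvgP.
  move=> t V /= /nbhs_singleton Vxt; exists [:: t] => z zx.
  by rewrite /= zx ?mem_head.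
have [|s sW] := cvgG W; first exact: open_nbhs_nbhs.
by exists s => z /sW; exact: WU.
Qed.

Lemma finite_relatively_discrete (D : set Nstar) :
  finite_set D -> relatively_discrete D.
Proof. by move=> fD y _; exact: isolate_from_finite Nstar_hausdorff fD. Qed.

Lemma finite_extension (s : seq Nstar) (g : Nstar -> bool) :
  exists x : Cp Nstar bool, {in s, Cp_eval x =1 g}.
Proof.
have [||x xP] := @relatively_discrete_extension [set` s] g.
- exact: finite_set_countable.
- exact: finite_relatively_discrete.
by exists x => y ys; exact: xP.
Qed.

(** * A weak limit makes the function space meagre *)

Lemma not_Baire_of_meagre (T : topologicalType) :
  [set: T] !=set0 -> meagre [set: T] -> ~ Baire_space T.
Proof.
move=> T0 [F [nF TF]] BT.
have [|z [_ zP]] := BT (fun n => ~` closure (F n)) _ setT T0 openT.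
  move=> n; split; first by rewrite openC; exact: closed_closure.
  move=> O [u Ou] oO; apply: contrapT => OF.
  have : interior (closure (F n)) u; last by rewrite nF.
  apply: (filterS _ (open_nbhs_nbhs (conj oO Ou))) => v Ov.
  by apply: contrapT => nv; apply: OF; exists v.
have [n _ Fz] : (\bigcup_n F n) z by rewrite -TF.
exact: (zP n Logic.I (subset_closure Fz)).
Qed.

Lemma trivIset_avoid_seq (T : eqType) (E : nat -> set T) (s : seq T) m :
  trivIset [set: nat] E ->
  exists2 n, (m <= n)%N & forall y, y \in s -> ~ E n y.
Proof.
move=> tE; elim: s m => [|z s IH] m; first by exists m.
have [k _ kP] : exists2 k, (m <= k)%N & forall n, (k <= n)%N -> ~ E n z.
  have [[j [mj Ejz]]|nE] := pselect (exists j, (m <= j)%N /\ E j z).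
    exists j.+1; first exact: leqW.
    move=> n jn Enz; have jE : j = n by apply: tE => //; exists z.
    by rewrite jE ltnn in jn.
  by exists m => // n mn Enz; apply: nE; exists n.
have [n kn nP] := IH (maxn m k).
move: kn; rewrite geq_max => /andP[mn kn].
by exists n => // y; rewrite inE => /predU1P[->|/nP//]; exact: kP.
Qed.

(** A continuous x is constant near [y0], so it takes the value [x y0] somewhere
    on all but finitely many of the [E k].  For a fixed value and a fixed
    starting index the functions with this property are nowhere dense, since a
    finite condition can be extended by the opposite value on some [E k]
    disjoint from its domain. *)
Lemma meagre_of_weak_limit (E : nat -> set Nstar) (y0 : Nstar) :
  (forall n, finite_set (E n)) -> trivIset [set: nat] E ->
  weakly_converges E y0 -> meagre [set: Cp Nstar bool].
Proof.
move=> fE tE Ey0.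
(* The parity of n codes the value, and n./2 the starting index. *)
exists (fun n => [set x : Cp Nstar bool | forall k, (n./2 <= k)%N ->
  exists2 y, E k y & Cp_eval x y = odd n]); split; last first.
  apply/esym/seteqP; split=> // x _; pose b := Cp_eval x y0.
  have [|m mP] := Ey0 (Cp_eval x @^-1` [set b]).
    exact: (@Cp_eval_continuous _ _ x y0 _ (discrete_set1 b)).
  exists (b + m.*2)%N => // k; rewrite half_bit_double => /mP[y [/= xy Ey]].
  by exists y => //; rewrite xy oddD odd_double addbF oddb.
move=> n; apply/seteqP; split=> // x /nbhs_CpP[s sF].
have [k nk ks] := trivIset_avoid_seq s n./2 tE.
have [e Ee] := (finite_seqP (E k)).1 (fE k).
have [z zP] := finite_extension (s ++ e) (fun y =>
   if y \in s then Cp_eval x y else ~~ odd n).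
have zs : {in s, Cp_eval z =1 Cp_eval x}.
  by move=> y ys; rewrite zP ?mem_cat ys.
have [|w [wF wz]] := sF z zs [set w | {in e, Cp_eval w =1 Cp_eval z}].
  by apply/nbhs_CpP; exists e.
have [y Ey wy] := wF k nk; have ye : y \in e by move: Ey; rewrite Ee.
move: (wz y ye); rewrite wy zP ?mem_cat ?ye ?orbT//.
by case: ifP => [/ks//|_]; case: odd.
Qed.

(** * Sequences of sets converging to all their points *)

(** If a neighborhood U of [y0] misses the weak limits in [E (p k)] for all k,
    then the points of U in these sets are isolated and some continuous x is
    equal to the parity of k on U `&` E (p k).  Near [y0] it is constant, so a
    neighborhood of [y0] misses the [E (p k)] with k of the other parity. *)
Lemma weakly_converges_to_limits (E : nat -> set Nstar) (y0 : Nstar) :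
  (forall n, finite_set (E n)) -> trivIset [set: nat] E ->
  (forall y, (\bigcup_n E n) y -> weakly_converges E y \/
    exists2 U, nbhs y U & exists m, forall n, (m <= n)%N -> U `&` E n = set0) ->
  weakly_converges E y0 ->
  weakly_converges (fun n => E n `&` weakly_converges E) y0.
Proof.
move=> fE tE dich Ey0 U y0U; apply: contrapT => nU.
have [|p pI pU] := @frequently_subsequence
    (fun n => U `&` (E n `&` weakly_converges E) = set0).
  move=> m; apply: contrapT => nm; apply: nU; exists m => n mn.
  by apply/set0P/eqP => UE; apply: nm; exists n.
pose D := \bigcup_k (U `&` E (p k)).
have cD : countable D.
  apply: bigcup_countable => // k _; apply: finite_set_countable.
  exact: finite_setIr.
have dD : relatively_discrete D.
  move=> y [k _ [Uy Ey]].
  have [||[V yV [m mV]]] := dich y; first by exists (p k).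
    by move=> yL; have : set0 y by rewrite -(pU k).
  have [|W yW WD] := @isolate_from_finite _ (\bigcup_(n in `I_m) E n) y
      Nstar_hausdorff.
    by apply: bigcup_finite => // n _; exact: fE.
  exists (V `&` W); first exact: filterI.
  move=> z [[Vz Wz] [j _ [Uz Ez]]]; apply: WD; split=> //.
  exists (p j) => //=; rewrite ltnNge; apply/negP => mp.
  by have : set0 z by rewrite -(mV _ mp).
have pinj i j y : E (p i) y -> E (p j) y -> i = j.
  move=> Ei Ej; apply: (homo_ltn_trivIset pI tE) => //.
  by exists y.
have [g gP] : exists g : Nstar -> bool, forall k y, E (p k) y -> g y = odd k.
  have [|g gP] := @choice _ _ (fun y b => forall k, E (p k) y -> b = odd k).
    move=> y; have [[k Ek]|nE] := pselect (exists k, E (p k) y).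
      by exists (odd k) => j Ej; rewrite (pinj _ _ _ Ek Ej).
    by exists true => k Ek; case: nE; exists k.
  by exists g => k y; exact: gP.
have [x xP] := relatively_discrete_extension g cD dD.
have [|m mP] := Ey0 (U `&` x @^-1` [set x y0]).
  by apply: filterI => //; apply: (@cts_fun _ _ x); exact: discrete_set1.
(* An index beyond m whose parity is not x y0. *)
pose k := (m.*2 + ~~ x y0)%N.
have [|y [[Uy /= xy] Ey]] := mP (p k).
  apply: leq_trans (homo_ltn_geid pI _).
  by apply: leq_trans (leq_addr _ _); rewrite -addnn leq_addr.
have Dy : D y by exists k.
by move: xy; rewrite xP // (gP k) // oddD odd_double oddb; case: (x y0).
Qed.

Lemma self_limiting_sequence (E : nat -> set Nstar) (y0 : Nstar) :
  (forall n, finite_set (E n)) -> trivIset [set: nat] E ->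
  weakly_converges E y0 ->
  exists E' : nat -> set Nstar,
    [/\ forall n, E' n !=set0, forall n, finite_set (E' n),
        trivIset [set: nat] E'
      & forall y, (\bigcup_n E' n) y -> weakly_converges E' y].
Proof.
move=> fE tE Ey0.
have cE : countable (\bigcup_n E n).
  by apply: bigcup_countable => // n _; exact: finite_set_countable.
have [f fI fP] := weak_limit_dichotomy E cE.
pose F := E \o f; have fF n : finite_set (F n) by exact: fE.
have tF : trivIset [set: nat] F by exact: homo_ltn_trivIset.
have lim y : weakly_converges F y ->
    weakly_converges (fun n => F n `&` weakly_converges F) y.
  apply: weakly_converges_to_limits => // z [n _ Fz].
  by apply: fP; exists (f n).
(* Only the terms from m on are known to contain a weak limit. *)
have [|m mP] := lim y0 (weakly_converges_subsequence fI Ey0) setT.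
  exact: filterT.
have sI : {homo addn m : i j / (i < j)%N} by move=> i j; rewrite ltn_add2l.
exists ((fun n => F n `&` weakly_converges F) \o addn m); split.
- by move=> n; have [|y [_]] := mP (m + n)%N; [exact: leq_addr | exists y].
- by move=> n; exact: finite_setIl.
- apply: homo_ltn_trivIset => //.
  move=> i j _ _ [y [[Fi _] [Fj _]]]; apply: tF => //.
  by exists y.
- move=> y [n _ [_ /lim]]; exact: weakly_converges_subsequence.
Qed.

(** * Without weak limits the function space is Baire *)

(** The values on [F] are left free, so the set [E] must work for each of the
    finitely many assignments r of values on [F].  Treat these in turn: extend
    r and the values already chosen off [F] to a continuous function, move it
    into O by density, and add to [E] the points off [F] of a finite condition
    that keeps it in O. *)
Lemma forcing_block (O : set (Cp Nstar bool)) (F : seq Nstar) :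
  open O -> dense O ->
  exists E : seq Nstar, (forall y, y \in E -> y \notin F) /\
    exists e : Nstar -> bool, forall x : Cp Nstar bool,
      {in E, Cp_eval x =1 e} -> O x.
Proof.
move=> oO dO.
(* The assignments are enumerated by recursion on the part F1 of F whose
   values are undecided, r giving the values on the rest F2. *)
suff core (F1 F2 : seq Nstar) (r : Nstar -> bool) (E : seq Nstar)
    (e : Nstar -> bool) : (forall y, (y \in F) = (y \in F1) || (y \in F2)) ->
    (forall y, y \in E -> y \notin F) ->
    exists E' : seq Nstar, [/\ {subset E <= E'},
      forall y, y \in E' -> y \notin F &
      exists2 e' : Nstar -> bool, {in E, e' =1 e} & forall x : Cp Nstar bool,
        {in E', Cp_eval x =1 e'} ->
        {in F2, Cp_eval x =1 r} -> O x].
  have [||E [_ EF [e _ eP]]] := core F [::] xpredT [::] xpredT => //.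
    by move=> y; rewrite orbF.
  by exists E; split=> //; exists e => x xe; exact: eP.
elim: F1 F2 r E e => [|t F1 IH] F2 r E e FE EF.
  have [x1 x1P] := finite_extension (F ++ E)
    (fun y => if y \in F then r y else e y).
  have [||x2 [x2N Ox2]] :=
      dO [set x | {in F ++ E, Cp_eval x =1 Cp_eval x1}]°.
  - by exists x1; apply/nbhs_CpP; exists (F ++ E).
  - exact: open_interior.
  have {}x2N := nbhs_singleton x2N; rewrite /= in x2N.
  have /nbhs_CpP[s sO] : nbhs x2 O by exact: open_nbhs_nbhs.
  exists (E ++ [seq y <- s | y \notin F]); split.
  - by move=> y yE; rewrite mem_cat yE.
  - by move=> y; rewrite mem_cat mem_filter => /orP[/EF|/andP[]].
  exists (Cp_eval x2).
    move=> y yE; rewrite x2N ?mem_cat ?yE ?orbT// x1P ?mem_cat ?yE ?orbT//.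
    by rewrite (negbTE (EF _ yE)).
  move=> x xE xr; apply: sO => y ys; have [yF|yF] := boolP (y \in F).
    rewrite xr; last by move: yF; rewrite FE.
    by rewrite x2N ?mem_cat ?yF// x1P ?mem_cat ?yF.
  by apply: xE; rewrite mem_cat mem_filter yF ys orbT.
pose r' b y := if y == t then b else r y.
have FE' y : (y \in F) = (y \in F1) || (y \in t :: F2).
  by rewrite FE !inE orbCA orbA.
have [E1 [EE1 E1F [e1 e1E e1P]]] := IH (t :: F2) (r' true) E e FE' EF.
have [E2 [EE2 E2F [e2 e2E e2P]]] := IH (t :: F2) (r' false) E1 e1 FE' E1F.
exists E2; split=> //; first by move=> y /EE1/EE2.
exists e2; first by move=> y yE; rewrite e2E ?e1E ?EE1.
move=> x xe xr.
have xr' : {in t :: F2, Cp_eval x =1 r' (Cp_eval x t)}.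
  move=> y; rewrite inE /r'; case: eqP => [->//|_ /=]; exact: xr.
case xt : (Cp_eval x t) xr'; last exact: e2P.
by apply: e1P => y yE1; rewrite xe ?EE2 ?e2E.
Qed.

(** Agreement with the block (E n, e n) forces membership in O 0, ..., O n, so a
    function that agrees with infinitely many blocks is in every O n.  Passing
    to a subsequence of the blocks is therefore harmless, and the absence of
    weak limits gives one on which all requirements can be met together. *)
Lemma Baire_of_no_weak_limit :
  (forall (E : nat -> set Nstar) (y0 : Nstar), (forall n, E n !=set0) ->
    (forall n, finite_set (E n)) -> trivIset [set: nat] E ->
    ~ weakly_converges E y0) ->
  Baire_space (Cp Nstar bool).
Proof.
move=> nW O OP U [x0 Ux0] oU.
have /nbhs_CpP[s0 s0U] : nbhs x0 U by exact: open_nbhs_nbhs.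
pose W := fix W n := if n is n'.+1 then W n' `&` O n else O 0%N.
have WP n : open (W n) /\ dense (W n).
  elim: n => [|n [oW dW]]; first exact: OP.
  have [oO dO] := OP n.+1.
  by split; [exact: openI | exact: denseI].
have WO k n : (k <= n)%N -> W n `<=` O k.
  elim: n => [|n IH]; first by rewrite leqn0 => /eqP->.
  rewrite leq_eqVlt => /predU1P[-> x []//|/IH kn].
  by apply: subset_trans kn => x [].
have block (nF : nat * seq Nstar) : exists Ee : seq Nstar * (Nstar -> bool),
    (forall y, y \in Ee.1 -> y \notin nF.2) /\
    forall x : Cp Nstar bool, {in Ee.1, Cp_eval x =1 Ee.2} -> W nF.1 x.
  have [oW dW] := WP nF.1.
  by have [E [EF [e eW]]] := forcing_block nF.2 oW dW; exists (E, e).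
have [h hP] := choice block.
(* F n collects the domain s0 and the blocks chosen before stage n. *)
pose F := fix F n := if n is n'.+1 then F n' ++ (h (n', F n')).1 else s0.
pose E n := (h (n, F n)).1; pose e n := (h (n, F n)).2.
have EF n y : y \in E n -> y \notin F n by exact: (hP (n, F n)).1.
have eW n (x : Cp Nstar bool) : {in E n, Cp_eval x =1 e n} -> W n x.
  exact: (hP (n, F n)).2.
have FS m n : (m <= n)%N -> {subset F m <= F n}.
  elim: n => [|n IH]; first by rewrite leqn0 => /eqP->.
  rewrite leq_eqVlt => /predU1P[->//|/IH mn] y /mn yF.
  by rewrite /= mem_cat yF.
have ES m n : (m < n)%N -> {subset E m <= F n}.
  by move=> mn y yE; apply: (FS m.+1 n mn); rewrite /= mem_cat yE orbT.
have Einj m n y : y \in E m -> y \in E n -> m = n.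
  move=> ym yn; case: (ltngtP m n) => // [mn|nm].
    by have := EF _ _ yn; rewrite (ES _ _ mn).
  by have := EF _ _ ym; rewrite (ES _ _ nm).
have tE : trivIset [set: nat] (fun n => [set` E n]).
  by move=> i j _ _ [y [/= yi yj]]; exact: Einj yi yj.
pose P := \bigcup_n [set` F n].
have cP : countable P.
  by apply: bigcup_countable => // n _; exact/finite_set_countable/finite_seq.
have [f fI fP] := weak_limit_dichotomy (fun n => [set` E n]) cP.
have {}fP y : P y -> exists2 U, nbhs y U &
    exists m, forall n, (m <= n)%N -> U `&` [set` E (f n)] = set0.
  move=> /fP[yW|//]; exfalso.
  have [|m mP] := yW setT; first exact: filterT.
  have sI : {homo addn m : i j / (i < j)%N} by move=> i j; rewrite ltn_add2l.
  apply: (nW ((fun n => [set` E (f n)]) \o addn m) y).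
  - by move=> n; have [|z [_]] := mP (m + n)%N; [exact: leq_addr | exists z].
  - by move=> n; exact: finite_seq.
  - exact: homo_ltn_trivIset sI (homo_ltn_trivIset fI tE).
  - exact: weakly_converges_subsequence.
pose D := [set` s0] `|` \bigcup_n [set` E (f n)].
have DP : D `<=` P.
  move=> y [ys|[n _ yn]]; first by exists 0%N.
  by exists (f n).+1 => //=; rewrite mem_cat yn orbT.
have dD : relatively_discrete D.
  move=> y /DP/fP[V yV [m mV]].
  have [|V' yV' V'D] := @isolate_from_finite _
      ([set` s0] `|` \bigcup_(n in `I_m) [set` E (f n)]) y Nstar_hausdorff.
    by rewrite finite_setU; split=> //; exact: bigcup_finite.
  exists (V `&` V'); first exact: filterI.
  move=> z [[Vz V'z] Dz]; apply: V'D; split=> //.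
  case: Dz => [zs|[n _ zn]]; [by left | right; exists n => //=].
  by rewrite ltnNge; apply/negP => mn; have : set0 z by rewrite -(mV _ mn).
have [g gP] : exists g : Nstar -> bool, {in s0, g =1 Cp_eval x0} /\
    forall n, {in E n, g =1 e n}.
  have [|g gP] := @choice _ _ (fun y b =>
      (y \in s0 -> b = Cp_eval x0 y) /\ forall n, y \in E n -> b = e n y).
    move=> y; have [[n yn]|nE] := pselect (exists n, y \in E n).
      exists (e n y); split=> [ys|k yk]; last by rewrite (Einj _ _ _ yn yk).
      by have := EF _ _ yn; rewrite (FS 0%N n).
    exists (Cp_eval x0 y); split=> // n yn.
    by case: nE; exists n.
  by exists g; split=> [y|n y]; [exact: (gP y).1 | exact: (gP y).2].
have [|x xP] := @relatively_discrete_extension D g _ dD.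
  by apply: sub_countable cP; exact: subset_card_le.
exists x; split.
  by apply: s0U => y ys; rewrite -gP.1 //; apply: xP; left.
move=> k _; apply: (WO k (f k)); first exact: homo_ltn_geid.
apply: eW => y yE; rewrite -gP.2 //; apply: xP.
by right; exists k.
Qed.

Theorem theorem4p1 :
  let Y := Nstar in
  let X := Cp Y bool in
  [<-> (* (i) *)
       meagre [set: X];
       (* (ii) *)
       ~ Baire_space X;
       (* (iii) *)
       exists E : nat -> set Y,
         [/\ forall n, E n !=set0,
             forall n, finite_set (E n),
             trivIset [set: nat] E
           & exists y0 : Y, weakly_converges E y0];
       (* (iv) *)
       exists E : nat -> set Y,
         [/\ forall n, E n !=set0,
             forall n, finite_set (E n),
             trivIset [set: nat] E
           & forall y : Y, (\bigcup_n E n) y -> weakly_converges E y]].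
Proof.
move=> Y X; tfae.
- apply: not_Baire_of_meagre.
  by have [x _] := finite_extension [::] xpredT; exists x.
- move=> nB; apply: contrapT => nE; apply: nB.
  apply: Baire_of_no_weak_limit => E y0 E0 fE tE Ey0; apply: nE.
  by exists E; split=> //; exists y0.
- by move=> [E [_ fE tE [y0 Ey0]]]; exact: self_limiting_sequence fE tE Ey0.
- move=> [E [E0 fE tE EW]]; have [y0 Ey0] := E0 0%N.
  by apply: (@meagre_of_weak_limit E y0) => //; apply: EW; exists 0%N.
Qed.
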